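(* There is an absolute constant $C>0$ such that the following holds. Let $\mathbb{F}_q$ be a finite field ($q$ an arbitrary prime power) and let $A\subset \mathbb{F}_q$. If $|(A+A)\cap (aG+b)|\le |G|^{1/2}$ for every subfield $G$ of $\mathbb{F}_q$, every $a\in\mathbb{F}_q^*$ and every $b\in\mathbb{F}_q$, then $$|A+A^2|\ge C\,|A|^{1+\frac{1}{84}}.$$
   Context: For $X,Y\subset\mathbb{F}_q$: $X+Y=\{x+y: x\in X,\,y\in Y\}$ and $X^2=\{x^2: x\in X\}$ (the set of squares of elements of $X$, not the product set). Thus $A+A^2=\{a+b^2: a,b\in A\}$. For a subfield $G$, $aG+b=\{ag+b: g\in G\}$. $\mathbb{F}_q^*=\mathbb{F}_q\setminus\{0\}$. The subfields $G$ include $\mathbb{F}_q$ itself. The constant $C$ does not depend on $q$ or $A$. *)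

(* Defs.v *)
From mathcomp Require Import all_boot all_order all_algebra.

Set Implicit Arguments.
Unset Strict Implicit.
Unset Printing Implicit Defensive.

Import GRing.Theory.
Local Open Scope ring_scope.

Definition sumset (F : finFieldType) (X Y : {set F}) : {set F} :=
  [set x + y | x in X, y in Y].

(* The squares of the elements of X, not the product set X * X. *)
Definition squares (F : finFieldType) (X : {set F}) : {set F} :=
  [set x ^+ 2 | x in X].

Definition affine_image (F : finFieldType) (a b : F) (G : {set F}) : {set F} :=
  [set a * g + b | g in G].

(* divring_closed: contains 1 and is closed under x - y and x / y; in a field
   x / 0 = 0, so this says exactly that G is a subfield. *)
Definition is_subfield (F : finFieldType) (G : {set F}) : Prop :=
  GRing.divring_closed (mem G).

(* Main.v *)
(** Let [Y] be the set of squares of [A], [N = #|A|] and [#|A + Y| = K N]. By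
    Plünnecke-Ruzsa, [A - A] and the sets [nY - mY] have size at most
    [2 K^2 N] and [K^(n+m) N]. If [d <> 0] is a popular difference of [A],
    then [2 d x - d^2 = x^2 - (x - d)^2] puts a translate of the dilate by
    [2 d] of a large part of [A] inside [Y - Y], so that [2 d A], and
    likewise products [4 d d' A], are covered by few translates of [Y - Y].
    Fix [a0] such that [a - a0] is popular for many [a] in [A], let [B] be the
    set of the corresponding [2 (a - a0)], and let
    [Q = {(b1 - b2) / (b3 - b4)}]. Either [Q] contains a subfield [G]
    containing [B], in which case [#|B|^2 <= #|G|] by hypothesis and averaging
    over [G] gives [x] in [Q] with [#|B + x B| >= #|B|^2 / 2], or some
    [x = 1 + r] or [x = b r] with [r] in [Q] and [b] in [B] is not in [Q], and
    then [#|B + x B| = #|B|^2]. After clearing the denominator, [B + x B] lies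
    in a sum of at most six dilates of [A] covered by [Y - Y], so
    [N^2 <= 2^29 K^54 N], which is stronger than the exponent [1 + 1/84].
    In characteristic 2 the hypothesis for [G = {0, 1}] forces [#|A| <= 1]. *)

Require Import Defs.
From mathcomp Require Import all_boot all_order all_algebra.
From mathcomp Require Import all_classical all_reals all_analysis.
(* [fintype] and [finset] are imported again because [all_classical] shadows
   some of their names, such as [set0] and [subsetP]. *)
From mathcomp Require Import fintype finset zify ring lra.

Set Implicit Arguments.
Unset Strict Implicit.
Unset Printing Implicit Defensive.

Import Order.TTheory GRing.Theory Num.Theory.
Local Open Scope ring_scope.

(** * Sumset calculus: Ruzsa's triangle and covering lemmas, Petridis' inequality *)

Definition dilate (F : finFieldType) (c : F) (X : {set F}) : {set F} :=
  [set c * x | x in X].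

Definition diffset (F : finFieldType) (X Y : {set F}) : {set F} :=
  [set x - y | x in X, y in Y].

Definition nsum (F : finFieldType) (n : nat) (X : {set F}) : {set F} :=
  iter n (sumset X) [set 0].

Section SumsetAlgebra.
Variable F : finFieldType.
Implicit Types (X Y Z T : {set F}) (a b c x y : F) (n m : nat).

Lemma sumsetP X Y z :
  reflect (exists x y, [/\ x \in X, y \in Y & z = x + y]) (z \in sumset X Y).
Proof.
apply: (iffP imset2P) => [[x y xX yY ->]|[x [y [xX yY ->]]]]; by exists x, y || exists x y.
Qed.

Lemma diffsetP X Y z :
  reflect (exists x y, [/\ x \in X, y \in Y & z = x - y]) (z \in diffset X Y).
Proof.
apply: (iffP imset2P) => [[x y xX yY ->]|[x [y [xX yY ->]]]]; by exists x, y || exists x y.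
Qed.

Lemma mem_sumset X Y x y : x \in X -> y \in Y -> x + y \in sumset X Y.
Proof. exact: imset2_f. Qed.

Lemma mem_diffset X Y x y : x \in X -> y \in Y -> x - y \in diffset X Y.
Proof. by move=> xX yY; apply/diffsetP; exists x, y. Qed.

Lemma sumsetC X Y : sumset X Y = sumset Y X.
Proof.
by apply/setP=> z; apply/sumsetP/sumsetP=> -[x [y [xX yY ->]]]; exists y, x; rewrite addrC.
Qed.

Lemma sumsetA X Y Z : sumset X (sumset Y Z) = sumset (sumset X Y) Z.
Proof.
apply/setP=> z; apply/sumsetP/sumsetP.
  move=> [x [w [xX /sumsetP[y [v [yY vZ ->]]] ->]]].
  by exists (x + y), v; rewrite mem_sumset // addrA.
move=> [w [v [/sumsetP[x [y [xX yY ->]]] vZ ->]]].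
by exists x, (y + v); rewrite mem_sumset // addrA.
Qed.

Lemma sumset0 X : sumset X [set 0] = X.
Proof.
apply/setP=> z; apply/sumsetP/idP => [[x [y [xX /set1P-> ->]]]|zX].
  by rewrite addr0.
by exists z, 0; rewrite set11 addr0.
Qed.

Lemma sumsetS X X' Y Y' :
  X \subset X' -> Y \subset Y' -> sumset X Y \subset sumset X' Y'.
Proof. exact: imset2S. Qed.

Lemma diffsetS X X' Y Y' :
  X \subset X' -> Y \subset Y' -> diffset X Y \subset diffset X' Y'.
Proof. exact: imset2S. Qed.

Lemma diffset_sumset_opp X Y : diffset X Y = sumset X (dilate (-1) Y).
Proof.
apply/setP=> z; apply/diffsetP/sumsetP => [[x [y [xX yY ->]]]|].
  by exists x, (-1 * y); split=> //; [apply: imset_f | rewrite mulN1r].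
by move=> [x [_ [xX /imsetP[y yY ->] ->]]]; exists x, y; rewrite mulN1r.
Qed.

Lemma card_sumset_le X Y : (#|sumset X Y| <= #|X| * #|Y|)%N.
Proof.
by rewrite /sumset curry_imset2X (leq_trans (leq_imset_card _ _)) // cardsX.
Qed.

Lemma card_dilate c X : c != 0 -> #|dilate c X| = #|X|.
Proof. by move=> c0; apply: card_imset; apply: mulfI. Qed.

Lemma dilateA c d X : dilate c (dilate d X) = dilate (c * d) X.
Proof. by rewrite /dilate -imset_comp; apply: eq_imset => x /=; rewrite mulrA. Qed.

Lemma dilate_sumset c X Y :
  dilate c (sumset X Y) = sumset (dilate c X) (dilate c Y).
Proof.
apply/setP=> z; apply/imsetP/sumsetP.
  move=> [_ /sumsetP[x [y [xX yY ->]]] ->].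
  by exists (c * x), (c * y); rewrite !imset_f // mulrDr.
move=> [_ [_ [/imsetP[x xX ->] /imsetP[y yY ->] ->]]].
by exists (x + y); rewrite ?mem_sumset // mulrDr.
Qed.

Lemma dilate_diffset c X Y :
  dilate c (diffset X Y) = diffset (dilate c X) (dilate c Y).
Proof.
by rewrite !diffset_sumset_opp dilate_sumset !dilateA [c * -1]mulrC.
Qed.

Lemma card_diffsetC X Y : #|diffset X Y| = #|diffset Y X|.
Proof.
rewrite -[LHS](@card_dilate (-1)) ?oppr_eq0 ?oner_eq0 // dilate_diffset.
apply: eq_card => z; apply/diffsetP/diffsetP.
  move=> [_ [_ [/imsetP[x xX ->] /imsetP[y yY ->] ->]]].
  by exists y, x; split=> //; ring.
move=> [y [x [yY xX ->]]]; exists (-1 * x), (-1 * y).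
by rewrite !imset_f //; split=> //; ring.
Qed.

Lemma card_sumset_geql X Y : Y != set0 -> (#|X| <= #|sumset X Y|)%N.
Proof.
move=> /set0Pn[y yY]; rewrite -(card_imset (mem X) (addIr y)).
by apply/subset_leq_card/subsetP=> _ /imsetP[x xX ->]; apply: mem_sumset.
Qed.

Lemma nsumS n X : nsum n.+1 X = sumset X (nsum n X).
Proof. by []. Qed.

Lemma nsum1 X : nsum 1 X = X.
Proof. exact: sumset0. Qed.

Lemma nsumD n m X : nsum (n + m) X = sumset (nsum n X) (nsum m X).
Proof.
elim: n => [|n IH]; first by rewrite sumsetC sumset0.
by rewrite addSn !nsumS IH sumsetA.
Qed.

(** Fix one representation [w = y - z] of each [w] in [Y - Z]. The map sending [(x, w)] to
    [(x + y, x + z)] is injective: the difference of the coordinates recovers [w], and then [x]. *)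
Lemma ruzsa_triangle X Y Z :
  (#|X| * #|diffset Y Z| <= #|sumset X Y| * #|sumset X Z|)%N.
Proof.
pose P w (p : F * F) := [&& p.1 \in Y, p.2 \in Z & p.1 - p.2 == w].
pose f w := odflt (0, 0) [pick p | P w p].
have fP w : w \in diffset Y Z -> P w (f w).
  move=> /diffsetP[y [z [yY zZ ->]]]; rewrite /f; case: pickP => //= /(_ (y, z)).
  by rewrite /P /= yY zZ eqxx.
pose g (u : F * F) := (u.1 + (f u.2).1, u.1 + (f u.2).2).
rewrite -!cardsX -(@card_in_imset _ _ g).
  apply/subset_leq_card/subsetP=> _ /imsetP[[x w] /setXP[/= xX /fP/and3P[p1 p2 _]] ->].
  by rewrite inE /= !mem_sumset.
move=> [x w] [x' w'] /setXP[/= xX /fP/and3P[_ _ /eqP e]] /setXP[/= _ /fP/and3P[_ _ /eqP e']].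
rewrite /g /= => -[e1 e2].
have ww : w = w'.
  rewrite -e -e' (_ : (f w).1 - _ = (x + (f w).1) - (x + (f w).2)); last by ring.
  by rewrite e1 e2; ring.
by move: e1; rewrite ww => /addIr->.
Qed.

Lemma ruzsa_triangleB X Y Z :
  (#|X| * #|diffset Y Z| <= #|diffset Y X| * #|diffset X Z|)%N.
Proof.
have N1 : (-1 : F) != 0 by rewrite oppr_eq0 oner_eq0.
rewrite -(card_dilate X N1) (leq_trans (ruzsa_triangle _ _ _)) //.
rewrite diffset_sumset_opp sumsetC leq_mul2l; apply/orP; right.
rewrite (card_diffsetC X) diffset_sumset_opp sumsetC; exact: leqnn.
Qed.

(** Take [T] maximal in [Z] with the translates [t - X] pairwise disjoint, which the cardinality
    equation in [P] encodes. By maximality [z - X] meets some [t - X], so [z] lies in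
    [t + X - X]. *)
Lemma ruzsa_covering X Z : X != set0 ->
  exists T : {set F}, (#|T| * #|X| <= #|diffset X Z|)%N /\
    Z \subset sumset T (diffset X X).
Proof.
move=> X0.
pose P (T : {set F}) := (T \subset Z) && (#|diffset T X| == #|T| * #|X|)%N.
have [|T /maxsetP[/andP[TZ /eqP cT] Tmax] _] := @maxset_exists F P set0.
  rewrite /P sub0set /= cards0 mul0n cards_eq0; apply/eqP/setP=> z.
  by rewrite inE; apply/diffsetP=> -[x [y []]]; rewrite inE.
exists T; split; first by rewrite -cT card_diffsetC subset_leq_card // diffsetS.
apply/subsetP=> z zZ; apply/negbNE/negP=> nz.
have zT : z \notin T.
  apply: contra nz => zT; case/set0Pn: X0 => x xX.
  by rewrite -[z]addr0 -(subrr x) mem_sumset // mem_diffset.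
have : z |: T = T; last by move=> e; rewrite -e setU11 in zT.
apply: Tmax; last exact: subsetU1.
rewrite /P subUset sub1set zZ TZ /=.
have -> : diffset (z |: T) X = [set z - x | x in X] :|: diffset T X.
  apply/setP=> w; apply/diffsetP/setUP.
    move=> [t [x [/setU1P[->|tT] xX ->]]]; first by left; apply/imsetP; exists x.
    by right; apply: mem_diffset.
  move=> [/imsetP[x xX ->]|/diffsetP[t [x [tT xX ->]]]].
    by exists z, x; rewrite setU11.
  by exists t, x; rewrite inE tT orbT.
rewrite cardsU disjoint_setI0 ?cards0 ?subn0.
  rewrite cT card_imset ?cardsU1 ?zT ?mulnDl ?mul1n //.
  by move=> x y /addrI/oppr_inj.
rewrite -setI_eq0; apply: contraNT nz => /set0Pn[w /setIP[/imsetP[x xX ->]]].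
move=> /diffsetP[t [y [tT yX e]]].
rewrite (_ : z = t + (x - y)); first by rewrite mem_sumset // mem_diffset.
by rewrite addrA -addrAC -e subrK.
Qed.

(** The hypothesis says that [X] minimizes [#|X' + Y| / #|X'|] among its nonempty subsets, with
    denominators cleared. The proof adds the points of [Z] one at a time. *)
Lemma petridis X Y Z :
    (forall X' : {set F}, X' \subset X ->
       (#|sumset X Y| * #|X'| <= #|sumset X' Y| * #|X|)%N) ->
  (#|sumset (sumset X Y) Z| * #|X| <= #|sumset X Y| * #|sumset X Z|)%N.
Proof.
move=> minX; have [n] := ubnP #|Z|; elim: n Z => // n IH Z.
have [->|/set0Pn[z zZ]] := eqVneq Z set0.
  suff -> : sumset (sumset X Y) set0 = set0 by rewrite cards0.
  by apply/setP=> w; rewrite inE; apply/sumsetP=> -[x [y []]]; rewrite inE.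
rewrite (cardsD1 z) zZ ltnS => /IH{IH}; set Z' := Z :\ z => IH.
have tr (S : {set F}) : #|sumset S [set z]| = #|S|.
  rewrite -(card_imset (mem S) (addIr z)); apply: eq_card => w.
  apply/sumsetP/imsetP => [[x [_ [xS /set1P-> ->]]]|[x xS ->]]; first by exists x.
  by exists x, z; rewrite set11.
have sp (S : {set F}) : sumset S Z = sumset S Z' :|: sumset S [set z].
  apply/setP=> w; rewrite -(setD1K zZ); apply/sumsetP/setUP.
    move=> [x [t [xS /setU1P[->|tZ] ->]]]; last by left; apply: mem_sumset.
    by right; rewrite mem_sumset // set11.
  case=> /sumsetP[x [t [xS tZ ->]]]; exists x, t; split=> //.
    by rewrite inE tZ orbT.
  by rewrite inE tZ.
(* Adding [z] enlarges [X + Z'] by exactly [#|X| - #|W|], and [X + Y + Z'] by at most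
   [#|X + Y| - #|X' + Y|]. Minimality at [X'] together with [#|W| <= #|X'|] compares the two
   gains. *)
pose X' := [set x in X | sumset [set x + z] Y \subset sumset (sumset X Y) Z'].
pose W := [set x in X | x + z \in sumset X Z'].
have WX' : (#|W| <= #|X'|)%N.
  apply/subset_leq_card/subsetP=> x; rewrite !inE => /andP[-> /sumsetP[x' [t [x'X tZ e]]]] /=.
  apply/subsetP=> _ /sumsetP[_ [y [/set1P-> yY ->]]].
  by rewrite e addrAC !mem_sumset.
have X'X : X' \subset X by apply/subsetP=> x /[!inE] /andP[].
have WX : W \subset X by apply/subsetP=> x /[!inE] /andP[].
have cXZ : (#|sumset X Z| = #|sumset X Z'| + #|X| - #|W|)%N.
  rewrite sp cardsU tr; congr (_ - _)%N; rewrite -[RHS]tr.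
  apply: eq_card => w; apply/setIP/sumsetP => [[wXZ /sumsetP[x [_ [xX /set1P-> e]]]]|].
    by exists x, z; rewrite !inE xX -e wXZ eqxx.
  move=> [x [_ [/[!inE]/andP[xX xz] /eqP-> ->]]].
  by rewrite xz (mem_sumset xX) ?set11.
have cXYZ : (#|sumset (sumset X Y) Z| <=
             #|sumset (sumset X Y) Z'| + (#|sumset X Y| - #|sumset X' Y|))%N.
  rewrite sp cardsU tr -addnBA ?leq_add2l ?leq_sub2l //; last first.
    by rewrite -[leqRHS]tr subset_leq_card // subsetIr.
  rewrite -tr; apply/subset_leq_card/subsetP=> w.
  case/sumsetP=> _ [_ [/sumsetP[x [y [xX' yY ->]]] /set1P-> ->]].
  move: (xX'); rewrite inE => /andP[xX /subsetP sx].
  apply/setIP; split; last by rewrite !mem_sumset ?set11.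
  by rewrite addrAC; apply: sx; rewrite mem_sumset ?set11.
have := minX X' X'X; have P'P : (#|sumset X' Y| <= #|sumset X Y|)%N.
  by rewrite subset_leq_card ?sumsetS.
have n'n := subset_leq_card X'X; have wn := subset_leq_card WX.
move: cXYZ; rewrite cXZ; nia.
Qed.

End SumsetAlgebra.

(** * Quotient sets of differences, subfields, and large sums [B + x B] *)

Section Pivot.
Variable F : finFieldType.
Implicit Types (B G Q : {set F}).

Definition quotients B : {set F} :=
  [set (p.1.1 - p.1.2) / (p.2.1 - p.2.2)
     | p : (F * F) * (F * F) in setX (setX B B) (setX B B) & p.2.1 != p.2.2].

Lemma quotientsP B z :
  reflect (exists b1 b2 b3 b4,
            [/\ [/\ b1 \in B, b2 \in B, b3 \in B & b4 \in B], b3 != b4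
              & z = (b1 - b2) / (b3 - b4)])
          (z \in quotients B).
Proof.
apply: (iffP imsetP) => [[[[b1 b2] [b3 b4]] /[!inE] /=
    /andP[/andP[/andP[? ?] /andP[? ?]] ?] ->]|].
  by exists b1, b2, b3, b4.
move=> [b1 [b2 [b3 [b4 [[m1 m2 m3 m4] ne ->]]]]].
by exists ((b1, b2), (b3, b4)); rewrite // !inE /= m1 m2 m3 m4.
Qed.

(** By finiteness, an injection of [Q] into itself permutes [Q]. This provides the inverses in the
    groups built from stabilizers of [Q]. *)
Lemma stable_injection Q (f : F -> F) : injective f ->
  (forall z, z \in Q -> f z \in Q) -> forall z, f z \in Q -> z \in Q.
Proof.
move=> fI fQ z fz; have /setP/(_ (f z)) : f @: Q = Q.
  apply/eqP; rewrite eqEcard card_imset // leqnn andbT.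
  by apply/subsetP=> _ /imsetP[x xQ ->]; apply: fQ.
by rewrite fz => /imsetP[x xQ /fI->].
Qed.

(* The translations preserving [Q] form an additive group [H] containing 1, and
   the multipliers preserving [H] form the subfield [G]. *)
Lemma stable_set_contains_subfield Q B :
    0 \in Q -> (forall z, z \in Q -> 1 + z \in Q) ->
    0 \notin B -> (forall b z, b \in B -> z \in Q -> b * z \in Q) ->
  exists G, [/\ is_subfield G, B \subset G & G \subset Q].
Proof.
move=> Q0 Q1 B0 QB.
pose H := [set h | [forall z in Q, h + z \in Q]].
pose G := [set x | [forall h in H, x * h \in H]].
have HP h : reflect (forall z, z \in Q -> h + z \in Q) (h \in H).
  by rewrite inE; apply: forall_inP.
have GP x : reflect (forall h, h \in H -> x * h \in H) (x \in G).
  by rewrite inE; apply: forall_inP.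
have HN h : h \in H -> - h \in H.
  move=> /HP hH; apply/HP => z zQ; apply: (stable_injection (addrI h) hH).
  by rewrite addNKr.
have HD h k : h \in H -> k \in H -> h + k \in H.
  by move=> /HP hH /HP kH; apply/HP=> z zQ; rewrite -addrA hH ?kH.
have G1 : 1 \in G by apply/GP=> h; rewrite mul1r.
have GM x y : x \in G -> y \in G -> x * y \in G.
  by move=> /GP xG /GP yG; apply/GP=> h hH; rewrite -mulrA xG ?yG.
have GV x : x \in G -> x^-1 \in G.
  have [->|x0] := eqVneq x 0; first by rewrite invr0.
  move=> /GP xG; apply/GP=> h hH; apply: (stable_injection (mulfI x0) xG).
  by rewrite mulVKf.
exists G; split.
- split=> // x y xG yG; last by rewrite GM ?GV.
  apply/GP=> h hH; rewrite mulrBl HD //; first exact: (GP _ xG).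
  exact/HN/(GP _ yG).
(* Write [b h + z = b (h + z / b)]; multiplication by [b] permutes [Q], so [z / b] is again in
   [Q]. *)
- apply/subsetP=> b bB; apply/GP=> h /HP hH; apply/HP=> z zQ.
  have b0 : b != 0 by apply: contraNneq B0 => <-.
  rewrite -[z](mulVKf b0) -mulrDr QB // hH //.
  apply: (stable_injection (mulfI b0)); first by move=> w; apply: QB.
  by rewrite mulVKf.
- apply/subsetP=> x /GP xG; have /HP/(_ 0 Q0) : x * 1 \in H by apply/xG/HP.
  by rewrite mulr1 addr0.
Qed.

Lemma sumset_dilate_imset B x :
  sumset B (dilate x B) = [set p.1 + x * p.2 | p in setX B B].
Proof.
apply/setP=> z; apply/sumsetP/imsetP.
  move=> [b [_ [bB /imsetP[b' b'B ->] ->]]]; exists (b, b') => //.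
  by rewrite inE bB.
move=> [[b b'] /setXP[/= bB b'B] ->]; exists b, (x * b').
by split=> //; apply: imset_f.
Qed.

(** A collision [b + x c = b' + x c'] with [c != c'] would write [x] as the quotient
    [(b - b') / (c' - c)]. *)
Lemma card_sumset_dilate_notin B x :
  x \notin quotients B -> #|sumset B (dilate x B)| = (#|B| ^ 2)%N.
Proof.
move=> xQ; rewrite -mulnn -cardsX sumset_dilate_imset.
apply: card_in_imset => -[b c] [b' c'] /setXP[/= bB cB] /setXP[/= b'B c'B] e.
have [cc|cc] := eqVneq c c'; first by move: e; rewrite cc => /addIr->.
case/negP: xQ; apply/quotientsP; exists b, b', c', c; split=> //; first by rewrite eq_sym.
have cc0 : c' - c != 0 by rewrite subr_eq0 eq_sym.
by apply: (canRL (mulfK cc0)); apply/eqP; rewrite -subr_eq0; apply/eqP;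
   transitivity (b' + x * c' - (b + x * c)); [ring | rewrite e subrr].
Qed.

(* The inequality [r ^ 2 >= 4 r - 4], summed over the representation counts
   [r] of the image points, replaces Cauchy-Schwarz. *)
Lemma card_imset_energy (I : finType) (D : {set I}) (f : I -> F) :
  (4 * #|D| <= #|[set p in setX D D | f p.1 == f p.2]| + 4 * #|f @: D|)%N.
Proof.
pose r z := #|[set x in D | f x == z]|.
have -> : #|D| = (\sum_(z in f @: D) r z)%N.
  rewrite -sum1_card (partition_big f (mem (f @: D))) /=; last by move=> x; apply: imset_f.
  by apply: eq_bigr => z _; rewrite /r -sum1_card; apply: eq_bigl => x; rewrite inE.
have -> : #|[set p in setX D D | f p.1 == f p.2]| = (\sum_(z in f @: D) r z ^ 2)%N.
  rewrite -sum1_card (partition_big (fun p => f p.1) (mem (f @: D))) /=.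
    apply: eq_bigr => z _; rewrite /r -mulnn -cardsX -sum1_card.
    apply: eq_bigl => -[x y]; rewrite !inE /=.
    case: (x \in D); case: (y \in D); rewrite //= ?andbF //.
    by have [->|] := eqVneq (f x) z; rewrite ?andbF ?andbT // eq_sym.
  by move=> [x y]; rewrite !inE /= => /andP[/andP[xD _] _]; apply: imset_f.
rewrite -sum1_card !big_distrr -big_split /=.
apply: leq_sum => z _; move: (r z) => n; rewrite muln1 -mulnn.
by have [?|?] := leqP n 2; nia.
Qed.

(** Collisions are counted on average over [x] in [G]. Were every sum smaller than [#|B|^2 / 2], the
    energy bound would give each [x] more than [2 #|B|^2] collisions. *)
Lemma exists_large_dilate_sum B G : G != set0 -> (#|B| ^ 2 <= #|G|)%N ->
  exists2 x, x \in G & (#|B| ^ 2 <= 2 * #|sumset B (dilate x B)|)%N.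
Proof.
move=> G0 BG; apply/exists_inP/negbNE/negP; rewrite negb_exists_in => /forall_inP small.
pose BB := setX B B.
pose hit (p : (F * F) * (F * F)) x := p.1.1 + x * p.1.2 == p.2.1 + x * p.2.2.
pose coll x := [set p in setX BB BB | hit p x].
have cBB : #|BB| = (#|B| ^ 2)%N by rewrite cardsX mulnn.
have lower x : x \in G -> (2 * #|B| ^ 2 < #|coll x|)%N.
  move=> xG; have := small x xG; rewrite -ltnNge sumset_dilate_imset -/BB.
  have := card_imset_energy BB (fun p => p.1 + x * p.2); rewrite cBB -/(coll x).
  have arith n a c : (4 * n <= c + 4 * a -> 2 * a < n -> 2 * n < c)%N by lia.
  exact: arith.
have : (\sum_(x in G) #|coll x| <= #|B| ^ 2 * #|G| + #|BB| * #|BB|)%N.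
  have -> : (\sum_(x in G) #|coll x| =
     \sum_(p in setX BB BB) #|[set x in G | hit p x]|)%N.
    under eq_bigr do rewrite -sum1_card; under [RHS]eq_bigr do rewrite -sum1_card.
    rewrite (exchange_big_dep (mem (setX BB BB))) /=; last by move=> x p _ /[!inE] /andP[].
    by apply: eq_bigr => p pX; apply: eq_bigl => x; move: pX; rewrite !inE => ->.
  (* If the second coordinates agree, a collision forces the two pairs to be equal, and then every
     [x] counts. Otherwise the equation is linear in [x] with at most one solution. *)
  rewrite (bigID (fun p : (F * F) * (F * F) => p.1.2 == p.2.2)) /=.
  apply: leq_add.
    rewrite (bigID (fun p : (F * F) * (F * F) => p.1.1 == p.2.1)) /= [X in (_ + X)%N]big1 ?addn0.
      apply: (@leq_trans (\sum_(p in [set (q, q) | q in BB]) #|G|)%N).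
        rewrite [leqLHS](eq_bigl (mem [set (q, q) | q in BB])).
          by apply: leq_sum => p _; apply/subset_leq_card/subsetP=> x /[!inE] /andP[].
        move=> [[a b] [c d]]; apply/idP/imsetP => /=.
          by move=> /andP[/andP[/setXP[/= abB _] /eqP e2] /eqP e1]; exists (a, b); rewrite // e1 e2.
        by move=> [[u v] uvB [-> -> -> ->]]; rewrite !eqxx !andbT; apply/setXP.
      by rewrite sum_nat_const card_imset ?cBB // => ? ? [].
    move=> p /andP[/andP[_ /eqP e] ne]; apply/eqP; rewrite cards_eq0; apply/eqP/setP=> x.
    by rewrite !inE /hit e (inj_eq (addIr _)) (negbTE ne) andbF.
  rewrite -cardsX -sum1_card [leqRHS](bigID (fun p : (F * F) * (F * F) => p.1.2 == p.2.2)) /=.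
  apply: leq_trans (leq_addl _ _); apply: leq_sum => p /andP[_ ne].
  apply/card_le1_eqP=> x y; rewrite !inE /hit => /andP[_ /eqP ex] /andP[_ /eqP ey].
  have : (x - y) * (p.1.2 - p.2.2) = 0.
    transitivity (p.1.1 + x * p.1.2 - (p.2.1 + x * p.2.2)
                  - (p.1.1 + y * p.1.2 - (p.2.1 + y * p.2.2))); first by ring.
    by rewrite ex ey !subrr.
  by move/eqP; rewrite mulf_eq0 !subr_eq0 (negbTE ne) orbF => /eqP.
apply/negP; rewrite -ltnNge cBB.
have : (#|B| ^ 2 * #|G| + #|B| ^ 2 * #|B| ^ 2 <= 2 * #|B| ^ 2 * #|G|)%N by nia.
move=> /leq_ltn_trans; apply; rewrite mulnC -sum_nat_const.
(* One term suffices for strictness; this is where [G] must be nonempty. *)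
case/set0Pn: G0 => g gG; rewrite (bigD1 g) // [ltnRHS](bigD1 g) //=.
by rewrite -addSn leq_add ?lower // leq_sum // => x /andP[xG _]; apply/ltnW/lower.
Qed.

(** The explicit form of [x] is recorded because multiplying by the denominator of [r] then turns
    [x] into a short expression in elements of [B]. *)
Lemma pivot B : (1 < #|B|)%N -> 0 \notin B ->
    (forall G, is_subfield G -> B \subset G -> (#|B| ^ 2 <= #|G|)%N) ->
  exists x, (#|B| ^ 2 <= 2 * #|sumset B (dilate x B)|)%N /\
    exists2 r, r \in quotients B &
      [\/ x = r, x = 1 + r | exists2 b, b \in B & x = b * r].
Proof.
move=> /card_gt1P[u [v [uB vB uv]]] B0 BG; set Q := quotients B.
have large x : x \notin Q -> (#|B| ^ 2 <= 2 * #|sumset B (dilate x B)|)%N.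
  by move/card_sumset_dilate_notin->; lia.
have [/exists_inP[r rQ nQ]|/exists_inPn Q1] := boolP [exists r in Q, 1 + r \notin Q].
  by exists (1 + r); split; [apply: large | exists r; [|constructor 2]].
have [/exists_inP[b bB /exists_inP[r rQ nQ]]|/exists_inPn QB] :=
    boolP [exists b in B, exists r in Q, b * r \notin Q].
  by exists (b * r); split; [apply: large | exists r; [|constructor 3; exists b]].
have Q0 : 0 \in Q by apply/quotientsP; exists u, u, u, v; rewrite subrr mul0r.
have [||G [sG BsG GQ]] := @stable_set_contains_subfield Q B Q0 _ B0.
- by move=> z /Q1/negbNE.
- by move=> b z /QB/exists_inPn h /h/negbNE.
have [|x xG lx] := @exists_large_dilate_sum B G _ (BG G sG BsG).
  by apply/set0Pn; exists 1; case: sG.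
by exists x; split=> //; exists x; [apply: (subsetP GQ) | constructor 1].
Qed.

End Pivot.

(** * Plünnecke-Ruzsa inequalities, coverings by translates, popular differences *)

Section Growth.
Variables (R : realFieldType) (F : finFieldType).
Implicit Types (A X Y Z T : {set F}) (K k : R).

Lemma card_gt0R X : X != set0 -> 0 < #|X|%:R :> R.
Proof. by rewrite ltr0n card_gt0. Qed.

(** For a nonempty [X] in [A] minimizing [#|X + Y| / #|X|], iterating [petridis] bounds [X + nY] by
    [k^n #|X|]. The triangle inequality through [X] then bounds [nY - mY]. *)
Lemma plunnecke_ruzsa A Y K n m : A != set0 ->
    #|sumset A Y|%:R <= K * #|A|%:R ->
  #|diffset (nsum n Y) (nsum m Y)|%:R <= K ^+ (n + m) * #|A|%:R.
Proof.
move=> A0 hK; pose ratio X : R := #|sumset X Y|%:R / #|X|%:R.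
have PA : (A \subset A) && (A != set0) by rewrite subxx.
case: (@arg_minP _ R _ A (fun X => (X \subset A) && (X != set0)) ratio PA) => X /andP[XA X0] Xmin; set k := ratio X in Xmin.
have cX0 := card_gt0R X0; have cA0 := card_gt0R A0.
have kE : #|sumset X Y|%:R = k * #|X|%:R by rewrite /k /ratio divfK // gt_eqF.
have k0 : 0 <= k by rewrite divr_ge0 // ler0n.
have kK : k <= K.
  by apply: (le_trans (Xmin A PA)); rewrite ler_pdivrMr.
have step Z : #|sumset X (sumset Y Z)|%:R <= k * #|sumset X Z|%:R.
  rewrite -(ler_pM2r cX0) mulrAC -kE sumsetA -!natrM ler_nat petridis // => X' X'X.
  have [->|X'0] := eqVneq X' set0; first by rewrite cards0 muln0.
  have := Xmin X'; rewrite (subset_trans X'X XA) X'0 => /(_ isT).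
  by rewrite /ratio ler_pdivlMr ?card_gt0R // -(ler_pM2r cX0) mulrAC -kE -!natrM ler_nat.
have iter n' : #|sumset X (nsum n' Y)|%:R <= k ^+ n' * #|X|%:R.
  elim: n' => [|n' IH]; first by rewrite sumset0 expr0 mul1r.
  by rewrite nsumS (le_trans (step _)) // exprS -mulrA ler_wpM2l.
rewrite -(ler_pM2l cX0) -natrM.
apply: (le_trans (y := #|sumset X (nsum n Y)|%:R * #|sumset X (nsum m Y)|%:R)).
  by rewrite -natrM ler_nat ruzsa_triangle.
apply: (le_trans (ler_pM _ _ (iter n) (iter m))); rewrite ?ler0n //.
rewrite mulrACA -exprD [leRHS]mulrCA ler_pM ?mulr_ge0 ?exprn_ge0 ?ler0n //.
  by rewrite lerXn2r ?nnegrE // (le_trans k0).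
by rewrite ler_pM2l // ler_nat subset_leq_card.
Qed.

(** Unlike a bound on [#|Z|], this notion passes to sumsets: the numbers of translates multiply and
    the indices [n] add. *)
Definition covered Y k n Z :=
  exists T, #|T|%:R <= k /\ Z \subset sumset T (diffset (nsum n Y) (nsum n Y)).

Lemma covered1 Y Z k : Y != set0 ->
  #|diffset Y Z|%:R <= k * #|Y|%:R -> covered Y k 1 Z.
Proof.
move=> Y0 hk; have [T [cT ZT]] := ruzsa_covering Z Y0.
exists T; rewrite nsum1; split=> //.
by rewrite -(ler_pM2r (card_gt0R Y0)) (le_trans _ hk) // -natrM ler_nat.
Qed.

Lemma coveredD Y Z Z' k k' n n' :
  covered Y k n Z -> covered Y k' n' Z' -> covered Y (k * k') (n + n') (sumset Z Z').
Proof.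
move=> [T [cT ZT]] [T' [cT' ZT']]; exists (sumset T T'); split.
  rewrite (le_trans _ (ler_pM _ _ cT cT')) ?ler0n // -natrM ler_nat.
  exact: card_sumset_le.
apply/subsetP=> _ /sumsetP[z [z' [/(subsetP ZT) zT /(subsetP ZT') zT' ->]]].
move: zT zT' => /sumsetP[t [_ [tT /diffsetP[x [y [xY yY ->]]] ->]]].
move=> /sumsetP[t' [_ [tT' /diffsetP[x' [y' [xY' yY' ->]]] ->]]].
rewrite (_ : _ + _ = t + t' + (x + x' - (y + y'))); last by ring.
by rewrite !nsumD !mem_sumset // mem_diffset // mem_sumset.
Qed.

Lemma coveredS Y Z Z' k n : Z' \subset Z -> covered Y k n Z -> covered Y k n Z'.
Proof. by move=> ZZ' [T [cT ZT]]; exists T; split=> //; apply: subset_trans ZT. Qed.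

Lemma card_covered Y Z k n : covered Y k n Z ->
  #|Z|%:R <= k * #|diffset (nsum n Y) (nsum n Y)|%:R.
Proof.
move=> [T [cT ZT]]; apply: le_trans (ler_wpM2r (ler0n _ _) cT).
rewrite -natrM ler_nat (leq_trans (subset_leq_card ZT)) //.
exact: card_sumset_le.
Qed.

(** The number of representations of [d] as a difference of two elements of [A]. *)
Definition diffcount A (d : F) := #|[set x in A | x - d \in A]|.

Lemma diffcountN A d : diffcount A (- d) = diffcount A d.
Proof.
rewrite /diffcount -(card_imset (mem [set x in A | x - d \in A]) (addrI (- d))).
apply: eq_card => z; rewrite inE opprK; apply/andP/imsetP.
  by move=> [zA zdA]; exists (z + d); rewrite ?inE ?addrK ?zA ?zdA // addrC addrK.
by move=> [x /[!inE] /andP[xA xdA] ->]; rewrite [- d + x]addrC subrK.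
Qed.

(** Differences with fewer than [t] representations account for at most [t #|A - A| <= #|A|^2 / 2]
    pairs, so for some [a0] not too many [a - a0] are rare. *)
Lemma exists_popular_point A (t : R) : (4 <= #|A|)%N -> 0 <= t ->
    2%:R * t * #|diffset A A|%:R <= #|A|%:R ^+ 2 ->
  exists2 a0, a0 \in A &
    #|A|%:R <=
      4%:R * #|[set a in A | (a != a0) && (t <= (diffcount A (a - a0))%:R)]|%:R :> R.
Proof.
move=> A4 t0 ht.
pose good a0 := [set a in A | (a != a0) && (t <= (diffcount A (a - a0))%:R)].
pose sparse d := (diffcount A d)%:R < t.
pose rare a0 := [set a in A | sparse (a - a0)].
have rareD : (\sum_(a0 in A) #|rare a0| =
               \sum_(d in diffset A A | sparse d) diffcount A d)%N.
  under eq_bigr do rewrite -sum1_card.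
  rewrite pair_big_dep /= (partition_big (fun p => p.2 - p.1)
    (fun d => (d \in diffset A A) && sparse d)) /=; last first.
    by move=> [a0 a]; rewrite !inE /= => /and3P[a0A aA ->]; rewrite mem_diffset.
  apply: eq_bigr => d /andP[dD dt].
  have inj : injective (fun x : F => (x - d, x)) by move=> x y [].
  rewrite /diffcount -(card_imset _ inj) -sum1_card; apply: eq_bigl => -[a0 a].
  rewrite !inE /=; apply/idP/imsetP.
    move=> /andP[/and3P[a0A aA _] /eqP <-]; exists a; rewrite ?inE ?aA //.
      by rewrite opprB addrC subrK a0A.
    by rewrite opprB addrC subrK.
  move=> [x /[!inE] /andP[xA xdA] [-> ->]].
  by rewrite xA xdA opprB addrC subrK dt eqxx.
have sum_rare : 2%:R * (\sum_(a0 in A) #|rare a0|)%:R <= #|A|%:R ^+ 2 :> R.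
  rewrite rareD natr_sum (le_trans _ ht) // -mulrA ler_pM2l ?ltr0n //.
  rewrite (le_trans (y := \sum_(d in diffset A A) t)) //; last first.
    by rewrite sumr_const mulr_natr.
  rewrite [leRHS](bigID sparse) /=.
  rewrite -[leLHS]addr0 lerD ?sumr_ge0 // ler_sum // => d /andP[_]; exact: ltW.
have cover a0 : a0 \in A -> (#|A| <= 1 + #|rare a0| + #|good a0|)%N.
  move=> a0A; rewrite -(cards1 a0).
  apply: leq_trans (leq_add (leq_card_setU _ _) (leqnn _)).
  apply: leq_trans (leq_card_setU _ _); apply/subset_leq_card/subsetP=> a aA.
  by rewrite !inE aA /=; case: eqP => //= _; rewrite /sparse; case: ltP.
apply/exists_inP/negbNE/negP; rewrite negb_exists_in => /forall_inP few.
have {}few a0 : a0 \in A -> 4%:R * #|good a0|%:R < #|A|%:R :> R.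
  by move=> /few; rewrite -ltNge.
(* The loss of 3 pays for [a = a0] and for the strict inequality in [few]. Summation gives
   [3 N^2 - 3 N <= 2 N^2] with [N = #|A|], which fails for [N >= 4]. *)
have many a0 : a0 \in A -> (3 * #|A| - 3 <= 4 * #|rare a0|)%N.
  move=> a0A; have := cover _ a0A; have := few _ a0A; rewrite -natrM ltr_nat; lia.
have : (\sum_(a0 in A) (3 * #|A| - 3) <= 4 * \sum_(a0 in A) #|rare a0|)%N.
  by rewrite big_distrr; apply: leq_sum.
by move: sum_rare; rewrite sum_nat_const -natrX -natrM ler_nat; nia.
Qed.

End Growth.

(** * Dilates of a set [A] for which [A + A^2] is small *)

Lemma card_squares (F : finFieldType) (A : {set F}) : (#|A| <= 2 * #|squares A|)%N.
Proof.
(* A choice of square root: each [x] is [s (x^2)] or its opposite. The default 0 is never taken on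
   squares. *)
pose s y := odflt 0 [pick x : F | x ^+ 2 == y].
have sP (x : F) : s (x ^+ 2) ^+ 2 = x ^+ 2.
  by rewrite /s; case: pickP => [z /eqP//|/(_ x)]; rewrite eqxx.
apply: (@leq_trans #|s @: squares A :|: [set - s y | y in squares A]|).
  apply/subset_leq_card/subsetP=> x xA; have := sP x => /eqP.
  rewrite eqf_sqr => /orP[]/eqP e; apply/setUP; [left|right]; apply/imsetP.
    by exists (x ^+ 2); rewrite ?e //; apply: imset_f.
  by exists (x ^+ 2); rewrite ?e ?opprK //; apply: imset_f.
by rewrite (leq_trans (leq_card_setU _ _)) // mul2n -addnn leq_add ?leq_imset_card.
Qed.

Section SmallDoubling.
Variables (R : realFieldType) (F : finFieldType) (A : {set F}) (K : R).
Hypothesis two_neq0 : 2%:R != 0 :> F.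
Hypothesis A_neq0 : A != set0.
Let Y := squares A.
Hypothesis cardAY : #|sumset A Y|%:R = K * #|A|%:R.

Let cA0 : 0 < #|A|%:R :> R. Proof. by rewrite ltr0n card_gt0. Qed.

Let Y_neq0 : Y != set0.
Proof. by case/set0Pn: A_neq0 => a aA; apply/set0Pn; exists (a ^+ 2); apply: imset_f. Qed.

Let cAY : #|A|%:R <= 2%:R * #|Y|%:R :> R.
Proof. by rewrite -natrM ler_nat card_squares. Qed.

Let leAY : #|sumset A Y|%:R <= K * #|A|%:R. Proof. by rewrite cardAY. Qed.

Lemma K_ge1 : 1 <= K.
Proof. by rewrite -(ler_pM2r cA0) mul1r -cardAY ler_nat card_sumset_geql. Qed.

Let K_gt0 : 0 < K. Proof. exact: lt_le_trans K_ge1. Qed.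

(** The triangle inequality through [Y]; the factor 2 comes from [#|A| <= 2 #|Y|]. *)
Lemma card_diffset_doubling : #|diffset A A|%:R <= 2%:R * K ^+ 2 * #|A|%:R.
Proof.
have : #|Y|%:R * #|diffset A A|%:R <= (K * #|A|%:R) ^+ 2 :> R.
  by rewrite -cardAY expr2 -!natrM ler_nat [sumset A _]sumsetC ruzsa_triangle.
set D := #|diffset _ _|%:R => h; rewrite -(ler_pM2l cA0).
have D0 : 0 <= D by rewrite ler0n.
have : #|A|%:R * D <= 2%:R * #|Y|%:R * D by rewrite ler_wpM2r.
move=> /le_trans; apply; rewrite -mulrA (le_trans (ler_wpM2l _ h)) //.
by lra.
Qed.

(** The constant is the product of the three losses in [popular_close]: [4 K^2] for the density of
    the popular part, [K^3] for [2Y - Y], and [2 K^2] for [A - A]. *)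
Definition close c := #|diffset Y (dilate c A)|%:R <= 8%:R * K ^+ 7 * #|A|%:R.

(* If [x] and [x - d] lie in [A], then [2 d x - d^2 = x^2 - (x - d)^2] lies in
   [Y - Y]: a dilate of a large part of [A] is absorbed by the squares. *)
Lemma popular_close d : d != 0 ->
  #|A|%:R / (4%:R * K ^+ 2) <= (diffcount A d)%:R -> close (2%:R * d).
Proof.
move=> d0; rewrite /diffcount; set Ad := [set x in A | _] => hd.
have c0 : 2%:R * d != 0 by rewrite mulf_neq0.
have K2 : 0 < 4%:R * K ^+ 2 by rewrite mulr_gt0 ?exprn_gt0 ?ltr0n.
move: hd; rewrite ler_pdivrMr // => hd.
have AdA : Ad \subset A by apply/subsetP=> x /[!inE] /andP[].
(* Translation by [d^2] moves [Y - 2 d Ad] into [2Y - Y]. *)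
have b1 : #|diffset Y (dilate (2%:R * d) Ad)|%:R <= K ^+ 3 * #|A|%:R.
  rewrite -[3%N]/(2 + 1)%N; apply: le_trans (plunnecke_ruzsa 2 1 A_neq0 leAY).
  rewrite ler_nat nsumS nsum1 -(card_imset (mem (diffset Y _)) (addIr (d ^+ 2))).
  apply/subset_leq_card/subsetP=> _ /imsetP[_ /diffsetP[y [_ [yY /imsetP[x xAd ->] ->]]] ->].
  move: xAd; rewrite inE => /andP[xA xdA].
  rewrite (_ : y - 2%:R * d * x + d ^+ 2 = y + (x - d) ^+ 2 - x ^+ 2); last by ring.
  by rewrite mem_diffset ?mem_sumset //; apply: imset_f.
have b2 : #|diffset (dilate (2%:R * d) Ad) (dilate (2%:R * d) A)|%:R <= 2%:R * K ^+ 2 * #|A|%:R.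
  rewrite -dilate_diffset card_dilate // (le_trans _ card_diffset_doubling) //.
  by rewrite ler_nat subset_leq_card // diffsetS.
have := ruzsa_triangleB (dilate (2%:R * d) Ad) Y (dilate (2%:R * d) A).
rewrite card_dilate // -(ler_nat R) !natrM /close => /le_trans/(_ (ler_pM _ _ b1 b2)).
rewrite !ler0n => /(_ isT isT); set X := #|diffset _ _|%:R => h.
rewrite -(ler_pM2l cA0).
have X0 : 0 <= X by rewrite ler0n.
apply: le_trans (ler_wpM2r X0 hd) _; rewrite mulrAC.
apply: le_trans (ler_wpM2r (ltW K2) h) _.
by lra.
Qed.

(** Two triangle inequalities: [Y] is compared with [c Y] through [c A], then [c Y] with [c d A].
    Closeness of [- c] is what bounds the sum [Y + c A]. *)
Lemma close_mul c d : c != 0 -> close (- c) -> close d ->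
  #|diffset Y (dilate (c * d) A)|%:R <= 128%:R * K ^+ 15 * #|A|%:R.
Proof.
move=> c0 cc cd.
have e1 : #|sumset (dilate c A) Y|%:R <= 8%:R * K ^+ 7 * #|A|%:R.
  apply: le_trans cc; rewrite sumsetC diffset_sumset_opp dilateA.
  by rewrite (_ : -1 * - c = c) //; ring.
have e2 : #|sumset (dilate c A) (dilate c Y)|%:R = K * #|A|%:R.
  by rewrite -dilate_sumset card_dilate.
have e3 : #|diffset Y (dilate c Y)|%:R <= 8%:R * K ^+ 8 * #|A|%:R.
  rewrite -(ler_pM2l cA0).
  have := ruzsa_triangle (dilate c A) Y (dilate c Y).
  rewrite card_dilate // -(ler_nat R) !natrM e2 => /le_trans; apply.
  apply: le_trans (ler_wpM2r (mulr_ge0 (ltW K_gt0) (ltW cA0)) e1) _.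
  by lra.
have e4 : #|diffset (dilate c Y) (dilate (c * d) A)|%:R <= 8%:R * K ^+ 7 * #|A|%:R.
  by rewrite -dilateA -dilate_diffset card_dilate.
have := ruzsa_triangleB (dilate c Y) Y (dilate (c * d) A).
rewrite card_dilate // -(ler_nat R) !natrM => /le_trans/(_ (ler_pM _ _ e3 e4)).
rewrite !ler0n => /(_ isT isT); set X := #|diffset Y (dilate (c * d) A)|%:R => h.
have X0 : 0 <= X by rewrite ler0n.
rewrite -(ler_pM2l cA0); apply: le_trans (ler_wpM2r X0 cAY) _.
rewrite -[leLHS]mulrA; apply: le_trans (ler_wpM2l (ler0n _ 2) h) _.
by lra.
Qed.

(** Ruzsa covering divides by [#|Y|], which is at least [#|A| / 2]; hence 16 in place of 8. *)
Lemma covered_close c : close c -> covered Y (16%:R * K ^+ 7) 1 (dilate c A).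
Proof.
move=> /le_trans cc; apply: covered1 => //; apply: cc.
rewrite (_ : 16%:R * K ^+ 7 * _ = 8%:R * K ^+ 7 * (2%:R * #|Y|%:R)); last by ring.
by rewrite ler_wpM2l // mulr_ge0 ?ler0n // exprn_ge0 // ltW.
Qed.

Lemma covered_close_mul c d : c != 0 -> close (- c) -> close d ->
  covered Y (256%:R * K ^+ 15) 1 (dilate (c * d) A).
Proof.
move=> c0 cc cd; have /le_trans h := close_mul c0 cc cd; apply: covered1 => //; apply: h.
rewrite (_ : 256%:R * K ^+ 15 * _ = 128%:R * K ^+ 15 * (2%:R * #|Y|%:R)); last by ring.
by rewrite ler_wpM2l // mulr_ge0 ?ler0n // exprn_ge0 // ltW.
Qed.

(** Plünnecke-Ruzsa for [nY - nY] contributes the additional exponent [n + n]. *)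
Lemma card_covered_pow Z m k n : 0 <= m ->
  covered Y (m * K ^+ k) n Z -> #|Z|%:R <= m * K ^+ (k + (n + n)) * #|A|%:R.
Proof.
move=> m0 /card_covered/le_trans; apply; rewrite exprD mulrA -[leRHS]mulrA.
by rewrite ler_wpM2l ?mulr_ge0 ?exprn_ge0 ?plunnecke_ruzsa // ltW.
Qed.

Lemma dilateD_sub (c d : F) : dilate (c + d) A \subset sumset (dilate c A) (dilate d A).
Proof.
by apply/subsetP=> _ /imsetP[a aA ->]; rewrite mulrDl mem_sumset //; apply: imset_f.
Qed.

Theorem card_small_doubling : (8 <= #|A|)%N ->
    (forall G : {set F}, is_subfield G -> forall a b : F, a != 0 ->
       (#|sumset A A :&: affine_image a b G| ^ 2 <= #|G|)%N) ->
  #|A|%:R <= 2%:R ^+ 29 * K ^+ 54.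
Proof.
move=> A8 Asub; have A4 : (4 <= #|A|)%N by apply: leq_trans A8.
have K2 : 0 < 4%:R * K ^+ 2 by rewrite mulr_gt0 ?exprn_gt0 ?ltr0n.
(* With this threshold [2 t #|A - A| <= #|A|^2], by [card_diffset_doubling]. *)
have t0 : 0 <= #|A|%:R / (4%:R * K ^+ 2) by rewrite divr_ge0 ?ler0n // ltW.
have [|a0 a0A] := exists_popular_point A4 t0.
  rewrite [2%:R * _]mulrCA mulrAC mulrA ler_pdivrMr // expr2 -!mulrA ler_pM2l //.
  by have := card_diffset_doubling; lra.
set P := [set a in A | _] => AP.
have PA : P \subset A by apply/subsetP=> a /[!inE] /andP[].
pose B : {set F} := [set 2%:R * (a - a0) | a in P].
have cBP : #|B| = #|P| by apply: card_imset => a b /(mulfI two_neq0)/addIr.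
have B1 : (1 < #|B|)%N by move: AP; rewrite cBP -natrM ler_nat; lia.
have B0 : 0 \notin B.
  apply/imsetP=> -[a]; rewrite inE => /and3P[_ aa0 _] /esym/eqP.
  by rewrite mulf_eq0 (negbTE two_neq0) subr_eq0 (negbTE aa0).
have Bclose b : b \in B -> close b /\ close (- b).
  move=> /imsetP[a]; rewrite inE => /and3P[_ aa0 pop] ->; split.
    by apply: popular_close; rewrite ?subr_eq0.
  by rewrite -mulrN; apply: popular_close; rewrite ?diffcountN // oppr_eq0 subr_eq0.
have [|x [Bx [r /quotientsP[b1 [b2 [b3 [b4 [[B_1 B_2 B_3 B_4] b34 rE]]]]] xE]]] :=
    pivot B1 B0.
  (* If [G] contains [B], then [a + a0 = (1/2) (2 (a - a0)) + 2 a0] puts the translate [P + a0] into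
     [A + A] and into the affine image [(1/2) G + 2 a0]. *)
  move=> G Gsub BG; have two_inv : 2%:R^-1 != 0 :> F by rewrite invr_eq0.
  apply: leq_trans (Asub G Gsub 2%:R^-1 (a0 + a0) two_inv).
  rewrite leq_exp2r // cBP -(card_imset (mem P) (addIr a0)).
  apply/subset_leq_card/subsetP=> _ /imsetP[a aP ->].
  apply/setIP; split; first by rewrite mem_sumset // (subsetP PA).
  apply/imsetP.
  exists (2%:R * (a - a0)); first by apply/(subsetP BG)/imset_f.
  by rewrite mulKf // addrA subrK.
(* Dilating by [e] clears the denominator of [r] without changing cardinalities. *)
pose e := b3 - b4; have e0 : e != 0 by rewrite subr_eq0.
have BxA : (#|sumset B (dilate x B)| <= #|sumset (dilate e A) (dilate (e * x)%R A)|)%N.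
  rewrite -dilateA -dilate_sumset card_dilate //.
  apply: leq_trans (leq_imset_card (fun z => 2%:R * z - 2%:R * (a0 + x * a0)) _).
  apply/subset_leq_card/subsetP=> w.
  case/sumsetP=> _ [_ [/imsetP[a aP ->] /imsetP[_ /imsetP[b bP ->] ->] ->]].
  apply/imsetP; exists (a + x * b); last by ring.
  by rewrite mem_sumset ?(subsetP PA) //; apply/imset_f/(subsetP PA).
have [/covered_close C1 _] := Bclose _ B_1; have [_ /covered_close C2] := Bclose _ B_2.
have [/covered_close C3 _] := Bclose _ B_3; have [_ /covered_close C4] := Bclose _ B_4.
have Ce : covered Y (2%:R ^+ 8 * K ^+ 14) 2 (dilate e A).
  rewrite (_ : _ * _ = (16%:R * K ^+ 7) * (16%:R * K ^+ 7)); last by ring.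
  exact: coveredS (dilateD_sub _ _) (coveredD C3 C4).
have C12 : covered Y (2%:R ^+ 8 * K ^+ 14) 2 (dilate (b1 - b2) A).
  rewrite (_ : _ * _ = (16%:R * K ^+ 7) * (16%:R * K ^+ 7)); last by ring.
  exact: coveredS (dilateD_sub _ _) (coveredD C1 C2).
have er : e * r = b1 - b2 by rewrite rE mulrC divfK.
(* Common bound for the three cases below, whose exponents of [K] are [28 + 8], [42 + 12] and
   [44 + 8]; twice the number of covered dilates is added each time. *)
have le54 m k : (m <= 24)%N -> (k <= 54)%N ->
    2%:R ^+ m * K ^+ k * #|A|%:R <= 2%:R ^+ 24 * K ^+ 54 * #|A|%:R.
  move=> m24 k54; rewrite ler_pM2r // ler_pM ?exprn_ge0 ?ler0n ?(ltW K_gt0) //.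
    by rewrite ler_weXn2l // ler1n.
  by rewrite ler_weXn2l // K_ge1.
have cS : #|sumset (dilate e A) (dilate (e * x) A)|%:R <= 2%:R ^+ 24 * K ^+ 54 * #|A|%:R.
  have pow2 n : 0 <= 2%:R ^+ n :> R by rewrite exprn_ge0 // ler0n.
  case: xE => [->|->|[b bB ->]].
  - apply: le_trans (le54 16 36%N isT isT).
    apply: (@card_covered_pow _ _ 28 4) => //.
    rewrite er (_ : _ * _ = (2%:R ^+ 8 * K ^+ 14) * (2%:R ^+ 8 * K ^+ 14)); last by ring.
    exact: coveredD Ce C12.
  - apply: le_trans (le54 24 54%N isT isT).
    apply: (@card_covered_pow _ _ 42 6) => //.
    rewrite mulrDr mulr1 er (_ : _ * _ = (2%:R ^+ 8 * K ^+ 14) *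
      ((2%:R ^+ 8 * K ^+ 14) * (2%:R ^+ 8 * K ^+ 14))); last by ring.
    apply: coveredS (coveredD Ce (coveredD Ce C12)).
    exact: sumsetS (subxx _) (dilateD_sub _ _).
  - apply: le_trans (le54 24 52%N isT isT).
    apply: (@card_covered_pow _ _ 44 4) => //.
    have b0 : b != 0 by apply: contraNneq B0 => <-.
    have [_ cb] := Bclose _ bB.
    have D1 := covered_close_mul b0 cb (Bclose _ B_1).1.
    have D2 := covered_close_mul b0 cb (Bclose _ B_2).2.
    rewrite [e * _]mulrCA er mulrDr (_ : _ * _ = (2%:R ^+ 8 * K ^+ 14) *
      ((256%:R * K ^+ 15) * (256%:R * K ^+ 15))); last by ring.
    apply: coveredS (coveredD Ce (coveredD D1 D2)).
    exact: sumsetS (subxx _) (dilateD_sub _ _).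
(* The constant [2^29] is [2^24], times 2 from [pivot], times [4^2] from [#|A| <= 4 #|P|]. *)
have B2 : #|P|%:R ^+ 2 <= 2%:R * (2%:R ^+ 24 * K ^+ 54 * #|A|%:R).
  apply: (le_trans (y := 2%:R * #|sumset B (dilate x B)|%:R)).
    by rewrite -cBP -natrX -natrM ler_nat.
  by rewrite ler_wpM2l ?ler0n // (le_trans _ cS) // ler_nat.
rewrite -(ler_pM2r cA0) -expr2.
apply: (le_trans (y := (4%:R * #|P|%:R) ^+ 2)).
  by rewrite lerXn2r ?nnegrE ?mulr_ge0 ?ler0n.
by rewrite exprMn; lra.
Qed.

End SmallDoubling.

(** * Characteristic 2 and the passage to the exponent [1 + 1/84] *)

(** Used with [G = {0, 1}] in characteristic 2, where two points on a line contradict the bound,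
    since [2^2 > 2]. *)
Lemma pair_in_line (F : finFieldType) (A : {set F}) x y : x \in A -> y \in A -> x != y ->
  forall G : {set F}, is_subfield G ->
  exists a b, a != 0 /\ (2 <= #|sumset A A :&: affine_image a b G|)%N.
Proof.
move=> xA yA xy G [G1 GB _]; exists (y - x), (x + x); split.
  by rewrite subr_eq0 eq_sym.
have G0 : 0 \in G by rewrite -(subrr 1) GB.
apply/card_gt1P; exists (x + x), (x + y); split.
- apply/setIP; split; first exact: mem_sumset.
  by apply/imsetP; exists 0; rewrite // mulr0 add0r.
- apply/setIP; split; first exact: mem_sumset.
  by apply/imsetP; exists 1; rewrite // mulr1; ring.
- by rewrite (inj_eq (addrI x)).
Qed.

Lemma prime_field2 (F : finFieldType) : 2%:R = 0 :> F -> is_subfield [set 0; 1 : F].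
Proof.
move=> two0; have N1 : - 1 = 1 :> F.
  by apply/eqP; rewrite eq_sym -addr_eq0 -[1 + 1]/(2%:R) two0.
split=> [|x y|x y]; first by rewrite !inE eqxx orbT.
  by rewrite !inE => /orP[]/eqP-> /orP[]/eqP->;
    rewrite ?subr0 ?subrr ?add0r ?N1 eqxx ?orbT.
by rewrite !inE => /orP[]/eqP-> /orP[]/eqP->; rewrite ?mul0r ?invr0 ?mulr0 ?divr1 eqxx ?orbT.
Qed.

Theorem corollary1p3 (R : realType) :
  exists C : R, 0 < C /\
    forall (F : finFieldType) (A : {set F}),
      (forall G : {set F}, is_subfield G ->
         forall a b : F, a != 0 ->
           #|sumset A A :&: affine_image a b G|%:R <= Num.sqrt (#|G|%:R : R)) ->
      C * (#|A|%:R `^ (1 + 1 / 84)) <= #|sumset A (squares A)|%:R.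
Proof.
exists 2%:R^-1; split=> [|F A Asub]; first by rewrite invr_gt0 ltr0n.
have {}Asub G : is_subfield G -> forall a b : F, a != 0 ->
    (#|sumset A A :&: affine_image a b G| ^ 2 <= #|G|)%N.
  move=> sG a b a0; rewrite -(ler_nat R) natrX -[leRHS]sqr_sqrtr ?ler0n //.
  by rewrite lerXn2r ?nnegrE ?ler0n ?sqrtr_ge0 // Asub.
set N : R := #|A|%:R; set M : R := #|sumset A (squares A)|%:R.
have N0 : 0 <= N by rewrite ler0n.
have M0 : 0 <= M by rewrite ler0n.
(* Both sides are raised to the power 84 to clear the real exponent, [C] being [1/2]. *)
suff main : N ^+ 85 <= (2%:R * M) ^+ 84.
  rewrite mulrC ler_pdivrMr ?ltr0n // [M * _]mulrC.
  rewrite -(@ler_pXn2r _ 84) ?nnegrE ?powR_ge0 ?mulr_ge0 ?ler0n //.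
  rewrite -powR_mulrn ?powR_ge0 // -powRrM.
  by rewrite (_ : (1 + 1 / 84) * 84%:R = 85%:R) ?powR_mulrn //; field.
have [A0|A0] := eqVneq A set0.
  by rewrite /N A0 cards0 expr0n /= exprn_ge0 // mulr_ge0 ?ler0n.
have NM : N <= M.
  rewrite ler_nat card_sumset_geql //; case/set0Pn: A0 => a aA.
  by apply/set0Pn; exists (a ^+ 2); apply: imset_f.
have N1 : 0 < N by rewrite ltr0n card_gt0.
(* For bounded [N] the trivial inequality [N <= M] is enough. *)
have small : N <= 2%:R ^+ 84 -> N ^+ 85 <= (2%:R * M) ^+ 84.
  move=> N8; rewrite exprS exprMn ler_pM ?exprn_ge0 //.
  by rewrite lerXn2r ?nnegrE.
have [A8|A8] := leqP #|A| 7.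
  apply: small; apply: (le_trans (y := 2%:R ^+ 3)).
    by rewrite -natrX ler_nat; apply: leq_trans A8 _.
  by rewrite ler_weXn2l // ler1n.
have [two0|two0] := eqVneq (2%:R : F) 0.
  have /card_gt1P[x [y [xA yA xy]]] : (1 < #|A|)%N by apply: leq_trans A8.
  have sG := prime_field2 two0.
  have [a [b [a0 big]]] := pair_in_line xA yA xy sG.
  have := leq_trans _ (Asub _ sG a b a0) => /(_ (2 ^ 2)%N).
  by rewrite leq_exp2r // big cards2 [_ == 1]eq_sym oner_eq0 => /(_ isT).
(* With [K = M / N] the bound becomes [N^55 <= 2^29 M^54]; multiplying by [N^30 <= M^30] gives the
   claim. *)
have MK : M = M / N * N by rewrite divfK // gt_eqF.
have := card_small_doubling two0 A0 MK A8 Asub.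
rewrite -/N expr_div_n mulrA ler_pdivlMr ?exprn_gt0 // -exprS => h.
have -> : (2%:R * M) ^+ 84 = 2%:R ^+ 84 * M ^+ 54 * M ^+ 30.
  by rewrite exprMn -[RHS]mulrA -exprD.
rewrite (exprD N 55 30) ler_pM ?exprn_ge0 //; last by rewrite lerXn2r ?nnegrE.
rewrite (le_trans h) // ler_wpM2r ?exprn_ge0 //.
by rewrite ler_weXn2l // ler1n.
Qed.
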